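(* We have $$\lim_{n\to\infty}\frac{\#\{m\in\mathbb{Z} : 0\le m\le n,\ s_1(m)\not\equiv 0 \pmod 8\}}{n}=0.$$
   Context: Let $q$ be a complex number with $|q|<1$ (or a formal variable). Write $(a;q)_\infty=\prod_{k=0}^\infty(1-aq^k)$. The integers $s_1(n)$, $n\ge 0$, are defined as the coefficients of the power series $$\sum_{n=0}^\infty s_1(n)q^n = S_1(q)=\sum_{n=0}^\infty (-q^{n+1};q)_\infty^2\, q^n .$$ *)

(* Defs.v *)
From HB Require Import structures.
From mathcomp Require Import all_boot all_order all_algebra.
From mathcomp Require Import boolp classical_sets.

Set Implicit Arguments.
Unset Strict Implicit.
Unset Printing Implicit Defensive.

Import Order.TTheory GRing.Theory Num.Theory.

Local Open Scope ring_scope.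

Record fps (R : Type) := Fps { fcoef : nat -> R }.

HB.instance Definition _ (R : Type) := gen_eqMixin (fps R).
HB.instance Definition _ (R : Type) := gen_choiceMixin (fps R).

Lemma fpsP (R : Type) (f g : fps R) : fcoef f =1 fcoef g -> f = g.
Proof. by case: f g => [f] [g] /= /funext ->. Qed.

Section FpsRing.
Variable R : comNzRingType.
Implicit Types f g h : fps R.

Definition fps_zero : fps R := Fps (fun=> 0).
Definition fps_opp f : fps R := Fps (fun n => - fcoef f n).
Definition fps_add f g : fps R := Fps (fun n => fcoef f n + fcoef g n).
Definition fps_one : fps R := Fps (fun n => (n == 0)%:R).
Definition fps_mul f g : fps R :=
  Fps (fun n => \sum_(i < n.+1) fcoef f i * fcoef g (n - i)).

Fact fps_addA : associative fps_add.
Proof. by move=> f g h; apply: fpsP => n /=; rewrite addrA. Qed.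
Fact fps_addC : commutative fps_add.
Proof. by move=> f g; apply: fpsP => n /=; rewrite addrC. Qed.
Fact fps_add0 : left_id fps_zero fps_add.
Proof. by move=> f; apply: fpsP => n /=; rewrite add0r. Qed.
Fact fps_addN : left_inverse fps_zero fps_opp fps_add.
Proof. by move=> f; apply: fpsP => n /=; rewrite addNr. Qed.

HB.instance Definition _ :=
  GRing.isZmodule.Build (fps R) fps_addA fps_addC fps_add0 fps_addN.

Definition fps_trunc n f : {poly R} := \poly_(i < n) fcoef f i.

Lemma coef_fps_mul n m f g : (m < n)%N ->
  fcoef (fps_mul f g) m = (fps_trunc n f * fps_trunc n g)`_m.
Proof.
move=> ltmn; rewrite coefM; apply: eq_bigr => i _.
rewrite !coef_poly (leq_ltn_trans (leq_subr _ _) ltmn).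
by rewrite (leq_ltn_trans _ ltmn) // -ltnS.
Qed.

Fact fps_mulC : commutative fps_mul.
Proof.
by move=> f g; apply: fpsP => n; rewrite !(@coef_fps_mul n.+1) // mulrC.
Qed.

Fact fps_mulA : associative fps_mul.
Proof.
move=> f g h; apply: fpsP => n.
transitivity (fps_trunc n.+1 f * (fps_trunc n.+1 g * fps_trunc n.+1 h))`_n.
  rewrite coefM; apply: eq_bigr => i _.
  by rewrite coef_poly ltn_ord (@coef_fps_mul n.+1) // ltnS leq_subr.
rewrite mulrA coefM; apply: eq_bigr => i _.
by rewrite coef_poly ltnS leq_subr (@coef_fps_mul n.+1).
Qed.

Fact fps_mul1 : left_id fps_one fps_mul.
Proof.
move=> f; apply: fpsP => n /=.
by rewrite big_ord_recl big1 ?addr0 ?mul1r ?subn0 // => i _; rewrite mul0r.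
Qed.

Fact fps_mulDl : left_distributive fps_mul fps_add.
Proof.
move=> f g h; apply: fpsP => n /=; rewrite -big_split /=.
by apply: eq_bigr => i _; rewrite mulrDl.
Qed.

Fact fps_one_neq0 : fps_one != 0.
Proof.
by apply/eqP => /(congr1 (fun f => fcoef f 0)) /eqP /=; rewrite oner_eq0.
Qed.

HB.instance Definition _ := GRing.Zmodule_isComNzRing.Build (fps R)
  fps_mulA fps_mulC fps_mul1 fps_mulDl fps_one_neq0.

Lemma fcoefD f g n : fcoef (f + g) n = fcoef f n + fcoef g n.
Proof. by []. Qed.

Lemma fcoefN f n : fcoef (- f) n = - fcoef f n.
Proof. by []. Qed.

Lemma fcoef1 n : fcoef (1 : fps R) n = (n == 0)%:R.
Proof. by []. Qed.

Lemma fcoefM f g n :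
  fcoef (f * g) n = \sum_(i < n.+1) fcoef f i * fcoef g (n - i).
Proof. by []. Qed.

End FpsRing.

Arguments fcoef : simpl never.

Section FpsLimit.
Variable R : comNzRingType.
Implicit Types f g a : fps R.

Definition fpsX : fps R := Fps (fun n => (n == 1)%:R).

(* Convergence in the X-adic topology: each coefficient is eventually
   constant. *)
Definition fps_cvg (u : nat -> fps R) (l : fps R) :=
  forall m, exists N, forall n, (N <= n)%N -> fcoef (u n) m = fcoef l m.

Definition fps_lim (u : nat -> fps R) : fps R :=
  xget 0 [set l | fps_cvg u l].

(* (a; q)_oo, where q is the indeterminate fpsX *)
Definition qpoch_inf (a : fps R) : fps R :=
  fps_lim (fun N => \prod_(k < N) (1 - a * fpsX ^+ k)).

Definition fps_series (t : nat -> fps R) : fps R :=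
  fps_lim (fun N => \sum_(n < N) t n).

Lemma fps_cvg_unique u l1 l2 : fps_cvg u l1 -> fps_cvg u l2 -> l1 = l2.
Proof.
move=> c1 c2; apply: fpsP => m.
have [N1 h1] := c1 m; have [N2 h2] := c2 m.
by rewrite -(h1 (maxn N1 N2)) ?leq_maxl // h2 ?leq_maxr.
Qed.

Lemma fps_lim_eq u l : fps_cvg u l -> fps_lim u = l.
Proof.
move=> c; apply: fps_cvg_unique (c).
exact: (xgetPex 0 (ex_intro (fps_cvg u) l c)).
Qed.

Lemma fps_limP u :
    (forall m n, (m < n)%N -> fcoef (u n.+1) m = fcoef (u n) m) ->
  fps_cvg u (fps_lim u).
Proof.
move=> st; suff [l c] : exists l, fps_cvg u l.
  exact: (xgetPex 0 (ex_intro (fps_cvg u) l c)).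
exists (Fps (fun m => fcoef (u m.+1) m)) => m; exists m.+1 => n /=.
elim: n => // n IHn; rewrite leq_eqVlt => /predU1P[[->]//|].
by rewrite ltnS => lt; rewrite st ?IHn.
Qed.

Lemma fcoefX n : fcoef fpsX n = (n == 1)%:R.
Proof. by []. Qed.

Lemma fcoefXn n m : fcoef (fpsX ^+ n) m = (m == n)%:R.
Proof.
elim: n m => [|n IHn] m; first by rewrite expr0 fcoef1.
rewrite exprS fcoefM; case: m => [|m]; first by rewrite big_ord1 fcoefX mul0r.
rewrite 2!big_ord_recl !fcoefX mul0r add0r mul1r subSS subn0 IHn.
by rewrite big1 ?addr0 // => i _; rewrite fcoefX mul0r.
Qed.

Lemma fcoef_mulXn_lt f n m : (m < n)%N -> fcoef (f * fpsX ^+ n) m = 0.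
Proof.
move=> lt; rewrite fcoefM big1 // => i _; rewrite fcoefXn.
by rewrite ltn_eqF ?mulr0 // (leq_ltn_trans (leq_subr _ _)).
Qed.

(* The two limits above exist, so the default value of xget is not used. *)
Lemma qpoch_inf_cvg a :
  fps_cvg (fun N => \prod_(k < N) (1 - a * fpsX ^+ k)) (qpoch_inf a).
Proof.
apply: fps_limP => m n lt; rewrite big_ord_recr /= mulrBr mulr1 mulrA.
by rewrite fcoefD fcoefN fcoef_mulXn_lt // subr0.
Qed.

Lemma fps_series_cvg (f : nat -> fps R) :
  fps_cvg (fun N => \sum_(n < N) f n * fpsX ^+ n)
          (fps_series (fun n => f n * fpsX ^+ n)).
Proof.
apply: fps_limP => m n lt; rewrite big_ord_recr /=.
by rewrite fcoefD fcoef_mulXn_lt // addr0.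
Qed.

End FpsLimit.

Arguments fpsX {R}.

Definition S1 : fps int :=
  fps_series (fun n => qpoch_inf (- fpsX ^+ n.+1) ^+ 2 * fpsX ^+ n).

Definition s1 (n : nat) : int := fcoef S1 n.

(* Main.v *)
Require Import Defs.
From mathcomp Require Import all_boot all_order all_algebra.
From mathcomp Require Import all_classical all_reals all_analysis.
From mathcomp Require Import ring lra zify.

(** Write (a) for the infinite product of the 1 - a X^k, and
    t_k = k(k+1)/2, p_k = k(3k+1)/2.  Telescoping the products
    (x X^n) (y X^(n+k+1)) over n shows that the tail series
    A_k = sum_n (x X^(n+1)) (y X^(n+k+1)) X^n satisfy
    x A_k + y X^(k+1) A_(k+1) = 1 - (x) (y X^(k+1))  [tail_series_rec].
    For x = y = -1, A_0 is S1, and unrolling the recurrence gives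
    S1 = 2 (-X) sum_k (-1)^k X^(t_k) (-X^(k+1)) - sum_k (-1)^k X^(t_k).
    A second telescoping, a case of the Rogers-Fine identity [rf_sum_rec],
    turns the first sum into (-X) times the false theta series
    sum_k X^(p_k) (1 - X^(2k+1)).  The same telescoping with the opposite
    sign gives Euler's pentagonal number theorem
    (X) = sum_k (-1)^k X^(p_k) (1 - X^(2k+1)), so that the false theta series
    is (X) + 2 R, where R keeps the terms of odd index.  Finally
    (X) (-X)^2 = sum_k X^(t_k) by Gauss [gauss_triangular], whence the
    exact formula [S1_theta]
      S1 = 2 sum_k X^(t_k) - sum_k (-1)^k X^(t_k) + 4 (-X)^2 R.

    Modulo 2, (-X)^2 is (X)^2, and the square of a series is supported modulo 2
    on the doubles of its exponents.  Hence if s1(n) is not divisible by 8, then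
    either n is triangular, or n = 2a + b with a and b generalized pentagonal
    numbers.  As 24 a + 1, 24 b + 1 and 8 t_k + 1 are squares, in both cases
    24 n + 3 is a value of the form x^2 + 2 y^2  [s1_mod8_form].

    These values have density 0 [form_density0].  If p = 5 or 7 mod 8 is prime,
    then -2 is not a square modulo p, so p cannot divide x^2 + 2 y^2 exactly
    once; by the Chinese remainder theorem the density is at most the product
    over such p < Z of 1 - 1/p + 1/p^2, for all Z.  This tends to 0 because
    the sum of the 1/p diverges [inert_sum_unbounded].  The divergence has an
    elementary proof: every integer that is 5 mod 8 has a prime factor that is
    5 or 7 mod 8; were the sum convergent, a sieve by the small such primes
    would leave a positive proportion of the class 5 mod 8, whereas the large
    ones could divide only a much smaller proportion of what is left. *)

Set Implicit Arguments.
Unset Strict Implicit.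
Unset Printing Implicit Defensive.

Import Order.TTheory GRing.Theory Num.Theory.
Import numFieldNormedType.Exports.

Local Open Scope classical_set_scope.
Local Open Scope ring_scope.

(** * Limits and sums of formal power series *)

Section Limits.
Variable R : comNzRingType.
Implicit Types (f g l a : fps R) (u v t : nat -> fps R).

Local Notation X := (@fpsX R).

Definition vanish n f := forall m, (m < n)%N -> fcoef f m = 0.

Lemma vanishMr n f g : vanish n f -> vanish n (f * g).
Proof.
move=> h m lt; rewrite fcoefM big1 // => i _.
by rewrite h ?mul0r // (leq_ltn_trans _ lt) // -ltnS.
Qed.

Lemma vanishMl n f g : vanish n g -> vanish n (f * g).
Proof. by rewrite mulrC; apply: vanishMr. Qed.

Lemma vanishXn k n : (n <= k)%N -> vanish n (X ^+ k).
Proof. by move=> le m lt; rewrite fcoefXn ltn_eqF // (leq_trans lt). Qed.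

Lemma fcoefB f g n : fcoef (f - g) n = fcoef f n - fcoef g n.
Proof. by []. Qed.

Lemma fcoef0 n : fcoef (0 : fps R) n = 0.
Proof. by []. Qed.

Lemma fcoef_sum (t : nat -> fps R) N m :
  fcoef (\sum_(n < N) t n) m = \sum_(n < N) fcoef (t n) m.
Proof. by elim: N => [|N IH]; rewrite ?big_ord0 // !big_ord_recr /= -IH. Qed.

Lemma fps_cvg_cst l : fps_cvg (fun=> l) l.
Proof. by move=> m; exists 0. Qed.

Lemma eq_fps_cvg u v l : u =1 v -> fps_cvg u l -> fps_cvg v l.
Proof. by move=> e c m; have [N h] := c m; exists N => n; rewrite -e; apply: h. Qed.

Lemma fps_cvg_subseq (k : nat -> nat) u l :
  (forall n, n <= k n)%N -> fps_cvg u l -> fps_cvg (u \o k) l.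
Proof.
move=> hk c m; have [N h] := c m; exists N => n le; apply: h.
exact: leq_trans (hk n).
Qed.

Lemma fps_cvgD u v f g :
  fps_cvg u f -> fps_cvg v g -> fps_cvg (fun n => u n + v n) (f + g).
Proof.
move=> cu cv m; have [N1 h1] := cu m; have [N2 h2] := cv m.
exists (maxn N1 N2) => n; rewrite geq_max => /andP[le1 le2].
by rewrite !fcoefD h1 ?h2.
Qed.

Lemma fps_cvgN u f : fps_cvg u f -> fps_cvg (fun n => - u n) (- f).
Proof. by move=> cu m; have [N h] := cu m; exists N => n le; rewrite !fcoefN h. Qed.

Lemma fps_cvg_below u f m : fps_cvg u f ->
  exists N, forall n, (N <= n)%N -> forall i, (i < m)%N ->
    fcoef (u n) i = fcoef f i.
Proof.
move=> cu; elim: m => [|m [N h]]; first by exists 0.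
have [N' h'] := cu m; exists (maxn N N') => n.
rewrite geq_max => /andP[le le'] i; rewrite ltnS leq_eqVlt.
by case/predU1P => [->|lt]; [apply: h' | apply: h].
Qed.

Lemma fps_cvgM u v f g :
  fps_cvg u f -> fps_cvg v g -> fps_cvg (fun n => u n * v n) (f * g).
Proof.
move=> cu cv m.
have [N1 h1] := fps_cvg_below m.+1 cu; have [N2 h2] := fps_cvg_below m.+1 cv.
exists (maxn N1 N2) => n; rewrite geq_max => /andP[le1 le2].
rewrite !fcoefM; apply: eq_bigr => i _.
by rewrite h1 ?h2 // ltnS leq_subr.
Qed.

Lemma fps_cvg_vanish u l : (forall n, vanish n (u n - l)) -> fps_cvg u l.
Proof.
move=> h m; exists m.+1 => n lt; apply/eqP; rewrite -subr_eq0 -fcoefB.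
by apply/eqP/h.
Qed.

Lemma fps_cvg0 u : (forall n, vanish n (u n)) -> fps_cvg u 0.
Proof. by move=> h; apply: fps_cvg_vanish => n; rewrite subr0. Qed.

Definition has_sum t l := fps_cvg (fun N => \sum_(n < N) t n) l.

Lemma has_sum_series t l : has_sum t l -> fps_series t = l.
Proof. exact: fps_lim_eq. Qed.

Lemma series_has_sum t : (forall n, vanish n (t n)) -> has_sum t (fps_series t).
Proof.
move=> h; apply: fps_limP => m n lt.
by rewrite big_ord_recr /= fcoefD h // addr0.
Qed.

Lemma eq_has_sum t t' l : t =1 t' -> has_sum t l -> has_sum t' l.
Proof. by move=> e; apply: eq_fps_cvg => N; apply: eq_bigr. Qed.

Lemma has_sumD t t' l l' :
  has_sum t l -> has_sum t' l' -> has_sum (fun n => t n + t' n) (l + l').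
Proof. by move=> h h'; apply: eq_fps_cvg (fps_cvgD h h') => N; rewrite big_split. Qed.

Lemma has_sumZ c t l : has_sum t l -> has_sum (fun n => c * t n) (c * l).
Proof.
by move=> h; apply: eq_fps_cvg (fps_cvgM (fps_cvg_cst c) h) => N; rewrite mulr_sumr.
Qed.

Lemma has_sumN t l : has_sum t l -> has_sum (fun n => - t n) (- l).
Proof. by move=> h; apply: eq_fps_cvg (fps_cvgN h) => N; rewrite sumrN. Qed.

Lemma has_sum_unique t l l' : has_sum t l -> has_sum t l' -> l = l'.
Proof. exact: fps_cvg_unique. Qed.

Lemma has_sum_tele u l : fps_cvg u l -> has_sum (fun n => u n - u n.+1) (u 0 - l).
Proof.
move=> cu; apply: eq_fps_cvg (fps_cvgD (fps_cvg_cst (u 0)) (fps_cvgN cu)) => N.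
elim: N => [|N IH]; first by rewrite big_ord0 subrr.
by rewrite big_ord_recr /= -IH; ring.
Qed.

Lemma has_sum_tele0 u : fps_cvg u 0 -> has_sum (fun n => u n - u n.+1) (u 0).
Proof. by move=> /has_sum_tele; rewrite subr0. Qed.

Lemma has_sum_shift t l : has_sum t l -> has_sum (fun n => t n.+1) (l - t 0).
Proof.
move=> h; have h' := fps_cvgD (fps_cvg_subseq (k := S) (fun n => leqnSn n) h) (fps_cvg_cst (- t 0)).
by apply: eq_fps_cvg h' => N /=; rewrite big_ord_recl /= addrC addKr.
Qed.

Lemma has_sum_head t l n :
  has_sum t l -> (forall i, vanish n (t i.+1)) -> vanish n (l - t 0).
Proof.
move=> /has_sum_shift c v m lt; have [N h] := c m.
by rewrite -(h N) // (fcoef_sum (fun i => t i.+1)) big1 // => i _; apply: v.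
Qed.

(** The remainders of the unrolled recurrence vanish in the limit because each
    multiplier [C k] is divisible by X. *)
Lemma has_sum_unroll (A B C : nat -> fps R) :
    (forall k, A k = B k + C k * A k.+1) -> (forall k, vanish 1 (C k)) ->
  has_sum (fun k => (\prod_(j < k) C j) * B k) (A 0).
Proof.
move=> step C0.
have van K : vanish K (\prod_(j < K) C j).
  elim: K => [|K IH] //= m; rewrite ltnS big_ord_recr /= => le.
  rewrite fcoefM big_ord_recr /= subnn C0 // mulr0 addr0.
  rewrite big1 // => i _; rewrite IH ?mul0r // (leq_trans (ltn_ord i)) //.
have E K : A 0 = \sum_(k < K) (\prod_(j < k) C j) * B k
                 + (\prod_(j < K) C j) * A K.
  elim: K => [|K IH]; first by rewrite !big_ord0 add0r mul1r.
  by rewrite IH !big_ord_recr /= (step K); ring.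
have /(fps_cvgD (fps_cvg_cst (A 0)))/= := fps_cvgN (fps_cvg0 (fun K => vanishMr (A K) (van K))).
rewrite oppr0 addr0; apply: eq_fps_cvg => K /=.
by rewrite [X in X - _](E K) addrK.
Qed.

(** Comparing coefficients in increasing degree: the unit constant term of [c]
    isolates the next coefficient of [f - g]. *)
Lemma fps_mulIl c f g : fcoef c 0 = 1 -> c * f = c * g -> f = g.
Proof.
move=> c0 /(congr1 (fun h => h - c * g)); rewrite subrr -mulrBr => e.
suff h m : vanish m (f - g).
  by apply: fpsP => m; apply/eqP; rewrite -subr_eq0 -fcoefB; apply/eqP/(h m.+1).
elim: m => [|m IH] // i; rewrite ltnS leq_eqVlt => /predU1P[->|]; last exact: IH.
have := congr1 (fun h => fcoef h m) e; rewrite fcoefM big_ord_recl /= c0 mul1r subn0.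
rewrite big1 ?addr0 // => j _; rewrite IH ?mulr0 //.
by have := ltn_ord j; rewrite /bump /=; lia.
Qed.

End Limits.

(** * Telescoping identities for q-products *)

Definition tri n := 'C(n.+1, 2).
Definition pent n := (tri n + n ^ 2)%N.

Lemma triS n : tri n.+1 = (tri n + n.+1)%N.
Proof. by rewrite /tri binS bin1. Qed.

Lemma leq_tri n : (n <= tri n)%N.
Proof. by case: n => // n; rewrite triS leq_addl. Qed.

Lemma pentS n : pent n.+1 = (pent n + (3 * n + 2))%N.
Proof. by rewrite /pent triS; lia. Qed.

Lemma tri_square n : (8 * tri n + 1 = (2 * n + 1) ^ 2)%N.
Proof. by elim: n => // n IH; rewrite triS; lia. Qed.

(** Together with [tri_square], this is what relates the exponents of the theta
    series below to quadratic forms. *)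
Lemma pent_square n : (24 * pent n + 1 = (6 * n + 1) ^ 2)%N.
Proof. by rewrite /pent; have := tri_square n; lia. Qed.

Section Identities.
Variable R : comNzRingType.
Implicit Types (f g l a x y e : fps R) (u v t : nat -> fps R).

Local Notation X := (@fpsX R).
Local Notation P := (@qpoch_inf R).

Lemma qpoch_infS a : P a = (1 - a) * P (a * X).
Proof.
apply: fps_cvg_unique (fps_cvgM (fps_cvg_cst (1 - a)) (qpoch_inf_cvg (a * X))).
apply: eq_fps_cvg (fps_cvg_subseq (k := S) (fun n => leqnSn n) (qpoch_inf_cvg a)) => N /=.
rewrite big_ord_recl expr0 mulr1; congr (_ * _); apply: eq_bigr => k _.
by rewrite /= -mulrA -exprS.
Qed.

Lemma qpoch_infXS a n : P (a * X ^+ n) = (1 - a * X ^+ n) * P (a * X ^+ n.+1).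
Proof. by rewrite qpoch_infS -mulrA -exprSr. Qed.

Lemma qpoch_inf_vanish n a : vanish n a -> vanish n (P a - 1).
Proof.
move=> va m lt; have [N h] := qpoch_inf_cvg a m.
rewrite fcoefB -(h N) // -fcoefB {h}; elim: N m lt => [|N IH] m lt.
  by rewrite big_ord0 subrr.
rewrite big_ord_recr /= mulrBr mulr1 addrAC fcoefB IH // sub0r.
have va' : vanish n (a * X ^+ N) by exact: vanishMr.
by rewrite (vanishMl _ va') ?oppr0.
Qed.

Lemma qpoch_inf_prod a n :
  P a = (\prod_(k < n) (1 - a * X ^+ k)) * P (a * X ^+ n).
Proof.
elim: n => [|n IH]; first by rewrite big_ord0 mul1r expr0 mulr1.
by rewrite {1}IH big_ord_recr /= qpoch_infXS mulrA.
Qed.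

Lemma fps_cvg_qpoch_inf a : fps_cvg (fun n => P (a * X ^+ n)) 1.
Proof.
by apply: fps_cvg_vanish => n; apply/qpoch_inf_vanish/vanishMl/vanishXn.
Qed.

Lemma qpoch_inf1 : P 1 = 0.
Proof. by rewrite qpoch_infS subrr mul0r. Qed.

Lemma qpoch_inf_coef0 a : fcoef a 0 = 0 -> fcoef (P a) 0 = 1.
Proof.
move=> a0; have va : vanish 1 a by case.
by have := qpoch_inf_vanish va (leqnn 1); rewrite fcoefB fcoef1 => /subr0_eq.
Qed.

(** The shift [k] is what makes the family closed under summation by parts;
    only [k = 0] is of interest in the end. *)
Definition tail_series x y k :=
  fps_series (fun n => P (x * X ^+ n.+1) * P (y * X ^+ (n + k).+1) * X ^+ n).

Lemma tail_seriesP x y k :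
  has_sum (fun n => P (x * X ^+ n.+1) * P (y * X ^+ (n + k).+1) * X ^+ n)
    (tail_series x y k).
Proof. by apply: series_has_sum => n; apply/vanishMl/vanishXn. Qed.

(** The products (x X^n) (y X^(n+k+1)) go from (x) (y X^(k+1)) at n = 0 to 1 in
    the limit, and each of their increments is x times the n-th term of
    [tail_series x y k] plus y X^(k+1) times that of [tail_series x y k.+1]. *)
Lemma tail_series_rec x y k :
  x * tail_series x y k + y * X ^+ k.+1 * tail_series x y k.+1
  = 1 - P x * P (y * X ^+ k.+1).
Proof.
pose u n := P (x * X ^+ n) * P (y * X ^+ k.+1 * X ^+ n).
have cu : fps_cvg u 1.
  by rewrite -[1]mulr1; apply: fps_cvgM; apply: fps_cvg_qpoch_inf.
have := has_sumN (has_sum_tele cu); rewrite opprB.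
have -> : u 0 = P x * P (y * X ^+ k.+1) by rewrite /u expr0 !mulr1.
apply: has_sum_unique.
have := has_sumD (has_sumZ x (tail_seriesP x y k))
  (has_sumZ (y * X ^+ k.+1) (tail_seriesP x y k.+1)).
apply: eq_has_sum => n; rewrite /u.
rewrite -!(mulrA y) -!exprD !addSn !addnS (qpoch_infXS x n) (addnC k).
rewrite (qpoch_infXS y (n + k).+1) !exprSr !exprD.
by ring.
Qed.

Lemma prod_Xtri (s : fps R) k :
  \prod_(j < k) (s * X ^+ j.+1) = s ^+ k * X ^+ tri k.
Proof.
elim: k => [|k IH]; first by rewrite big_ord0 mulr1.
by rewrite big_ord_recr /= IH triS exprD (exprS s); ring.
Qed.

Lemma vanish1_X (s : fps R) k : vanish 1 (s * X ^+ k.+1).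
Proof. exact/vanishMl/vanishXn. Qed.

Lemma tail_seriesNN :
  has_sum (fun k => (-1) ^+ k * X ^+ tri k
                    * (P (-1) * P (- X ^+ k.+1) - 1)) (tail_series (-1) (-1) 0).
Proof.
have := @has_sum_unroll R (tail_series (-1) (-1))
  (fun k => P (-1) * P (- X ^+ k.+1) - 1) (fun k => (-1) * X ^+ k.+1).
move=> H; apply: eq_has_sum (H _ _) => [k|k|k]; last exact: vanish1_X.
  by rewrite prod_Xtri.
have := tail_series_rec (-1) (-1) k; rewrite !mulN1r.
set p := _ * P _; set A := tail_series _ _ k; set A' := tail_series _ _ k.+1 => E.
by rewrite -[p - 1]opprB -E; ring.
Qed.

(** Here the product (x) is (1) = 0, so only the powers of X remain. *)
Lemma tail_series1N :
  has_sum (fun k => X ^+ tri k) (tail_series 1 (-1) 0).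
Proof.
have := @has_sum_unroll R (tail_series 1 (-1)) (fun k => 1) (fun k => 1 * X ^+ k.+1).
move=> H; apply: eq_has_sum (H _ _) => [k|k|k]; last exact: vanish1_X.
  by rewrite prod_Xtri expr1n mul1r mulr1.
have := tail_series_rec 1 (-1) k; rewrite qpoch_inf1 mul0r subr0.
set A := tail_series _ _ k; set A' := tail_series _ _ k.+1; set x := X ^+ _ => E.
by transitivity (1 * A + -1 * x * A' + 1 * x * A'); [ring | rewrite E].
Qed.

Definition pent_term e k := (- e) ^+ k * X ^+ pent k * (1 - X ^+ (2 * k).+1).

(** Up to the factor (e X^(m+1)), the n-th term of the Rogers-Fine series
    sum_n (-1)^n X^(2mn + n(n+1)/2) / ((1 - e X^(m+1)) ... (1 - e X^(m+n))). *)
Definition rf_term e m n :=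
  (-1) ^+ n * X ^+ (2 * m * n + tri n) * P (e * X ^+ (m + n).+1).

Lemma rf_term_vanish e m n : vanish n (rf_term e m n).
Proof.
apply/vanishMr/vanishMl/vanishXn/(leq_trans (leq_tri n)); exact: leq_addl.
Qed.

Definition rf_sum e m := fps_series (rf_term e m).

Lemma rf_sumP e m : has_sum (rf_term e m) (rf_sum e m).
Proof. exact/series_has_sum/rf_term_vanish. Qed.

(** Telescoping with the certificate (1 - X^(2m+n+1)) [rf_term e m n]; the
    hypothesis on [e] turns e - X^(m+1) into e (1 - e X^(m+1)). *)
Lemma rf_sum_rec e m : e ^+ 2 = 1 ->
  rf_sum e m = (1 - X ^+ (2 * m).+1) * P (e * X ^+ m.+1)
     + (- e) * X ^+ (3 * m).+2 * (1 - e * X ^+ m.+1) * rf_sum e m.+1.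
Proof.
move=> e2; set c := - e * _ * _.
pose u n := (1 - X ^+ (2 * m + n).+1) * rf_term e m n.
have cu : fps_cvg u 0 by apply: fps_cvg0 => n; apply/vanishMl/rf_term_vanish.
apply/eqP; rewrite -subr_eq; apply/eqP.
have := has_sum_tele0 cu.
have -> : u 0 = (1 - X ^+ (2 * m).+1) * P (e * X ^+ m.+1).
  by rewrite /u /rf_term !(muln0, addn0, expr0, mul1r).
apply: has_sum_unique; rewrite -mulNr.
have := has_sumD (rf_sumP e m) (has_sumZ (- c) (rf_sumP e m.+1)).
apply: eq_has_sum => n; rewrite /u /rf_term /c triS !addnS.
rewrite (qpoch_infXS e (m + n).+1) !addSn.
have E3 : e * (1 - e * X ^+ m.+1) = e - X ^+ m.+1.
  by rewrite mulrBr mulr1 mulrA -expr2 e2 mul1r.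
set Q := P _.
have {E3} -> : - e * X ^+ (3 * m).+2 * (1 - e * X ^+ m.+1)
   = - (X ^+ (3 * m).+2 * (e - X ^+ m.+1)) by rewrite -E3; ring.
have [-> -> ->] : [/\ (3 * m).+2 = (m + m + m).+2,
   (2 * m.+1 * n + tri n = (m + m) * n + n + n + tri n)%N &
   (2 * m * n.+1 + (tri n + n)).+1 = (m + m + (m + m) * n + tri n + n).+1].
  by split; lia.
have -> : (2 * m = m + m)%N by lia.
rewrite !exprS !exprD; ring.
Qed.

(** Unrolling [rf_sum_rec]: the factors 1 - e X^(j+1) that it releases rebuild
    (e X) from its tails, and the exponents 3 j + 2 add up to [pent k]. *)
Lemma rf_sum_pent e : e ^+ 2 = 1 ->
  has_sum (fun k => P (e * X) * pent_term e k) (rf_sum e 0).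
Proof.
move=> e2; have := has_sum_unroll (fun k => rf_sum_rec k e2).
move=> H; apply: eq_has_sum (H _) => k; last first.
  by apply/vanishMr/vanish1_X.
rewrite /pent_term.
have -> : \prod_(j < k) (- e * X ^+ (3 * j).+2 * (1 - e * X ^+ j.+1))
    = (- e) ^+ k * X ^+ pent k * \prod_(j < k) (1 - e * X * X ^+ j).
  elim: k => [|k IH]; first by rewrite !big_ord0 !mulr1.
  rewrite !big_ord_recr /= IH pentS addn2 (exprS (- e)) exprD.
  by rewrite -(mulrA e X) -(exprS X); ring.
by rewrite (qpoch_inf_prod (e * X) k) -(mulrA e X) -exprS; ring.
Qed.

(** The series sum_n (-1)^n X^(jn + n(n+1)/2) (X^(n+1)) get multiplied by
    1 - X^(j+1) when j + 1 is replaced by j, and tend to (X) for large j. *)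
Lemma euler_square : has_sum (rf_term 1 0) (P X * P X).
Proof.
pose t j n := (-1) ^+ n * X ^+ (j * n + tri n) * P (1 * X ^+ n.+1).
have tv j n : vanish n (t j n).
  apply/vanishMr/vanishMl/vanishXn/(leq_trans (leq_tri n)); exact: leq_addl.
pose L j := fps_series (t j).
have LP j : has_sum (t j) (L j) by exact: series_has_sum.
have Lrec j : L j = (1 - X ^+ j.+1) * L j.+1.
  pose u n := (-1) ^+ n * X ^+ (j * n + tri n) * P (1 * X ^+ n).
  have u0 : u 0 = 0 by rewrite /u expr0 mulr1 qpoch_inf1 mulr0.
  have cu : fps_cvg u 0.
    apply: fps_cvg0 => n; apply/vanishMr.
    by apply/vanishMl/vanishXn/(leq_trans (leq_tri n))/leq_addl.
  apply/eqP; rewrite mulrBl mul1r -subr_eq0 opprB addrA; apply/eqP.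
  have := has_sum_tele0 cu; rewrite u0; apply: has_sum_unique.
  have := has_sumD (has_sumD (LP j) (has_sumZ (X ^+ j.+1) (LP j.+1)))
            (has_sumN (LP j.+1)).
  apply: eq_has_sum => n; rewrite /t /u (qpoch_infXS 1 n) triS.
  rewrite mulnS !mulSn.
  have -> : (j + j * n + (tri n + n.+1) = j.+1 + (n + (j * n + tri n)))%N by lia.
  rewrite -addnA !exprD !exprS; ring.
have L1 : fps_cvg L (P X).
  apply: fps_cvg_vanish => n.
  have <- : t n 0 = P X by rewrite /t muln0 (expr0 X) !mul1r.
  apply: has_sum_head (LP n) _ => i.
  by apply/vanishMr/vanishMl/vanishXn; nia.
have Lprod J : L 0 = \prod_(j < J) (1 - X * X ^+ j) * L J.
  elim: J => [|J IH]; first by rewrite big_ord0 mul1r.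
  by rewrite IH big_ord_recr /= Lrec exprS mulrA.
have -> : P X * P X = L 0.
  apply: fps_cvg_unique (fps_cvg_cst (L 0)).
  by apply: eq_fps_cvg (fps_cvgM (qpoch_inf_cvg X) L1) => J; rewrite -Lprod.
by apply: eq_has_sum (LP 0) => n; rewrite /t /rf_term muln0 mul0n.
Qed.

(** Comparing [rf_sum_pent] for e = 1 with [euler_square] gives the square of (X)
    on one side and (X) times the pentagonal series on the other. *)
Lemma pentagonal : has_sum (pent_term 1) (P X).
Proof.
have := rf_sum_pent (expr1n _ 2); rewrite mul1r.
rewrite (has_sum_unique (rf_sumP 1 0) euler_square) => H.
have pv : forall n, vanish n (pent_term 1 n).
  move=> n; apply/vanishMr/vanishMl/vanishXn.
  exact/(leq_trans (leq_tri n))/leq_addr.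
rewrite (@fps_mulIl _ (P X) (P X) (fps_series (pent_term 1))).
- exact: series_has_sum.
- by rewrite qpoch_inf_coef0.
- exact/(has_sum_unique H)/has_sumZ/series_has_sum.
Qed.

(** With [tail_series1N], this is Gauss's formula for the generating series of
    the triangular numbers.  Inserting X^(2jn) into the sum multiplies it by
    (1 - X) (1 - X^3) ... (1 - X^(2j-1)), and leaves (X) (-X) for large j.
    Since (X) is the product of (X) (-X) and of all these odd factors, the
    square of (X) (-X) is (X) times the sum. *)
Lemma gauss_triangular : tail_series 1 (-1) 0 = P X * P (- X) ^+ 2.
Proof.
pose t j n := X ^+ (2 * j * n) * (P (1 * X ^+ n.+1) * P (-1 * X ^+ n.+1) * X ^+ n).
have tv j n : vanish n (t j n) by apply/vanishMl/vanishMl/vanishXn.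
pose K j := fps_series (t j).
have KP j : has_sum (t j) (K j) by exact: series_has_sum.
have K0 : tail_series 1 (-1) 0 = K 0.
  apply: has_sum_unique (tail_seriesP _ _ _) _; apply: eq_has_sum (KP 0) => n.
  by rewrite /t mul1r addn0 muln0 mul0n expr0 mul1r.
have Krec j : K j.+1 = (1 - X ^+ (2 * j).+1) * K j.
  pose u n := X ^+ ((2 * j).+1 * n) * (P (1 * X ^+ n) * P (-1 * X ^+ n)).
  have u0 : u 0 = 0 by rewrite /u expr0 mulr1 qpoch_inf1 mul0r mulr0.
  have cu : fps_cvg u 0.
    by apply: fps_cvg0 => n; apply/vanishMr/vanishXn; rewrite leq_pmull.
  apply/eqP; rewrite mulrBl mul1r -subr_eq0 opprB; apply/eqP.
  have := has_sumN (has_sum_tele0 cu); rewrite u0 oppr0.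
  apply: has_sum_unique.
  have := has_sumD (KP j.+1) (has_sumD (has_sumZ (X ^+ (2 * j).+1) (KP j)) (has_sumN (KP j))).
  apply: eq_has_sum => n; rewrite /t /u.
  rewrite (qpoch_infXS 1 n) (qpoch_infXS (-1) n).
  have -> : (2 * j.+1 * n = 2 * j * n + n + n)%N by lia.
  rewrite mulnS mulSn !exprD !exprS.
  ring.
have K1 : fps_cvg K (P X * P (- X)).
  apply: fps_cvg_vanish => n.
  have <- : t n 0 = P X * P (- X).
    by rewrite /t muln0 (expr0 X) !mul1r mulN1r mulr1.
  apply: has_sum_head (KP n) _ => i.
  by apply/vanishMr/vanishXn; nia.
have Kprod J : K J = \prod_(j < J) (1 - X ^+ (2 * j).+1) * K 0.
  elim: J => [|J IH]; first by rewrite big_ord0 mul1r.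
  by rewrite Krec IH big_ord_recr /=; ring.
(* 1 - X^(2k) factors as (1 - X^k) (1 + X^k). *)
have split2 J : \prod_(k < 2 * J) (1 - X * X ^+ k)
    = \prod_(j < J) (1 - X ^+ (2 * j).+1)
      * (\prod_(k < J) (1 - X * X ^+ k) * \prod_(k < J) (1 - (- X) * X ^+ k)).
  elim: J => [|J IH]; first by rewrite !big_ord0 !mulr1.
  rewrite mulnS !big_ord_recr /= IH -!exprS.
  have -> : (2 * J).+2 = (J.+1 + J.+1)%N by lia.
  by rewrite exprD mulNr -exprS; ring.
rewrite K0; apply: (@fps_mulIl _ (P X)); first by rewrite qpoch_inf_coef0.
rewrite mulrA.
have c2 : (forall n, n <= 2 * n)%N by move=> n; lia.
have H1 := fps_cvgM (fps_cvg_subseq c2 (qpoch_inf_cvg X)) (fps_cvg_cst (K 0)).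
have H2 := fps_cvgM (fps_cvgM (qpoch_inf_cvg X) (qpoch_inf_cvg (- X))) K1.
apply: fps_cvg_unique H1 _.
have -> : P X * P X * P (- X) ^+ 2 = P X * P (- X) * (P X * P (- X)) by ring.
by apply: eq_fps_cvg H2 => J /=; rewrite split2 Kprod; ring.
Qed.

End Identities.

(** * The coefficients of S1 modulo 8 *)

Section Parity.
Local Notation X := (@fpsX int).
Local Notation P := (@qpoch_inf int).

(** Half the difference between the false theta series (all signs +) and
    Euler's pentagonal series (signs (-1)^k). *)
Definition oddpent_sum : fps int :=
  fps_series (fun k => (odd k)%:R * X ^+ pent k * (1 - X ^+ (2 * k).+1)).

Lemma oddpent_sumP :
  has_sum (fun k => (odd k)%:R * X ^+ pent k * (1 - X ^+ (2 * k).+1)) oddpent_sum.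
Proof.
apply: series_has_sum => k; apply/vanishMr/vanishMl/vanishXn.
exact/(leq_trans (leq_tri k))/leq_addr.
Qed.

Lemma false_theta : has_sum (pent_term (-1)) (P X + oddpent_sum + oddpent_sum).
Proof.
have := has_sumD (has_sumD (pentagonal int) oddpent_sumP) oddpent_sumP.
apply: eq_has_sum => k; rewrite /pent_term opprK expr1n -signr_odd.
by case: (odd k); rewrite ?expr0 ?expr1 /=; ring.
Qed.

(** In 2 (-X)^2 ((X) + 2 R), the part 2 (-X)^2 (X) is twice Gauss's series. *)
Lemma S1_theta (theta : fps int) : has_sum (fun k => (-1) ^+ k * X ^+ tri k) theta ->
  S1 = (tail_series 1 (-1) 0 + tail_series 1 (-1) 0) - theta
       + 4%:R * (P (- X) ^+ 2 * oddpent_sum).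
Proof.
move=> thetaP.
have -> : S1 = tail_series (-1) (-1) 0.
  apply: has_sum_series; apply: eq_has_sum (tail_seriesP _ _ _) => n.
  by rewrite addn0 mulN1r expr2.
have P1 : P (-1) = P (- X) + P (- X).
  by rewrite qpoch_infS mulN1r; ring.
have e2 : (-1 : fps int) ^+ 2 = 1 by rewrite sqrrN expr1n.
have r0 : rf_sum (-1) 0 = P (- X) * (P X + oddpent_sum + oddpent_sum).
  rewrite -(mulN1r X).
  exact/(has_sum_unique (rf_sum_pent e2))/has_sumZ/false_theta.
have -> : tail_series (-1) (-1) 0 = P (-1) * rf_sum (-1) 0 - theta.
  apply: has_sum_unique (tail_seriesNN int) _.
  have := has_sumD (has_sumZ (P (-1)) (rf_sumP (-1) 0)) (has_sumN thetaP).
  by apply: eq_has_sum => k; rewrite /rf_term mul0n add0n mulN1r; ring.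
by rewrite r0 gauss_triangular P1; ring.
Qed.

Definition even_coefs (f : fps int) := forall m, (2 %| fcoef f m)%Z.

Lemma even_coefsD f g : even_coefs f -> even_coefs g -> even_coefs (f + g).
Proof. by move=> ef eg m; rewrite fcoefD rpredD. Qed.

Lemma even_coefsMr f g : even_coefs f -> even_coefs (f * g).
Proof. by move=> ef m; rewrite fcoefM rpred_sum // => i _; apply/dvdz_mulr/ef. Qed.

Lemma even_coefs_lim u l : (forall n, even_coefs (u n)) -> fps_cvg u l -> even_coefs l.
Proof. by move=> eu c m; have [N h] := c m; rewrite -(h N) //; apply: eu. Qed.

Lemma even_coefs_qpoch_infB : even_coefs (P (- X) - P X).
Proof.
apply: even_coefs_lim (fps_cvgD (qpoch_inf_cvg (- X)) (fps_cvgN (qpoch_inf_cvg X))).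
elim=> [|n IH]; first by rewrite !big_ord0 subrr => m; rewrite dvdz0.
rewrite !big_ord_recr /=; set p := \prod_(_ < _) _; set p' := \prod_(_ < _) _.
have -> : p * (1 - - X * X ^+ n) - p' * (1 - X * X ^+ n)
  = (p - p') * (1 - X * X ^+ n) + 2%:R * (p * X * X ^+ n) by ring.
apply: even_coefsD; first exact: even_coefsMr.
by apply: even_coefsMr => m; rewrite mulr2n fcoefD fcoef1; case: m.
Qed.

(** In the convolution, the terms of indices i and m - i are equal, so only the
    middle one counts modulo 2. *)
Lemma fcoef_sqr_parity (f : fps int) m : ~~ (2 %| fcoef (f ^+ 2) m)%Z ->
  exists2 a, m = (2 * a)%N & fcoef f a != 0.
Proof.
rewrite expr2 fcoefM.
pose g i := fcoef f i * fcoef f (m - i).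
(* The convolution is symmetric about m / 2. *)
have g_rev i : (i <= m)%N -> g (m - i)%N = g i.
  by move=> le; rewrite /g subKn // mulrC.
have S2 k : (k <= m)%N -> \sum_(m.+1 - k <= i < m.+1) g i = \sum_(0 <= i < k) g i.
  elim: k => [|k IH] lt; first by rewrite subn0 !big_geq.
  rewrite subSS big_ltn; last by rewrite ltnS leq_subr.
  rewrite -subSn ?(ltnW lt) // IH ?(ltnW lt) // [RHS]big_nat_recr //=.
  by rewrite addrC g_rev // ltnW.
rewrite -(big_mkord xpredT g).
have [m2|m2] := boolP (odd m).
  have -> : \sum_(0 <= i < m.+1) g i
      = (\sum_(0 <= i < m./2.+1) g i) *+ 2.
    rewrite (big_cat_nat (n := m./2.+1)) //=; last by lia.
    rewrite mulr2n; congr (_ + _); rewrite -S2; last by lia.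
    by congr (\sum_(_ <= i < _) _); lia.
  by rewrite -mulr_natr dvdz_mull.
have -> : \sum_(0 <= i < m.+1) g i
    = (\sum_(0 <= i < m./2) g i) *+ 2 + g m./2.
  rewrite (big_cat_nat (n := m./2.+1)) //=; last by lia.
  rewrite big_nat_recr //= mulr2n addrAC; congr (_ + _ + _); rewrite -S2; last by lia.
  by congr (\sum_(_ <= i < _) _); lia.
rewrite GRing.rpredDl; last by rewrite -mulr_natr dvdz_mull.
move=> h; exists m./2; first by lia.
by apply: contraNneq h => e; rewrite /g e mul0r dvdz0.
Qed.

Definition supported (S : nat -> Prop) (f : fps int) := forall m, fcoef f m != 0 -> S m.

Lemma supported_sum (S : nat -> Prop) t l :
  (forall k, supported S (t k)) -> has_sum t l -> supported S l.
Proof.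
move=> h c m; have [N e] := c m; rewrite -(e N) // fcoef_sum {e c} => nz.
have /existsP[i] : [exists i : 'I_N, fcoef (t i) m != 0].
  rewrite -negb_forall; apply: contra nz => /forallP z.
  by rewrite big1 // => i _; apply/eqP.
exact: h.
Qed.

Lemma supported_sign (S : nat -> Prop) k f : supported S f -> supported S ((-1) ^+ k * f).
Proof.
move=> h m; rewrite -signr_odd; case: (odd k); last by rewrite mul1r; apply: h.
by rewrite expr1 mulN1r fcoefN oppr_eq0; apply: h.
Qed.

Lemma supported_Xn (S : nat -> Prop) k : S k -> supported S (X ^+ k).
Proof. by move=> Sk m; rewrite fcoefXn; case: (eqVneq m k) => [->|]. Qed.

Lemma supported_pent (S : nat -> Prop) k :
  S (pent k) -> S (pent k + (2 * k).+1)%N -> supported S (X ^+ pent k * (1 - X ^+ (2 * k).+1)).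
Proof.
move=> Sk Sk' m; rewrite mulrBr mulr1 -exprD fcoefB !fcoefXn.
case: (eqVneq m (pent k)) => [->|_] //.
by case: (eqVneq m (pent k + _)) => [->|_].
Qed.

Definition gen_pent m := exists x, (24 * m + 1 = x ^ 2)%N.

Lemma supported_gen_pent k : supported gen_pent (X ^+ pent k * (1 - X ^+ (2 * k).+1)).
Proof.
apply: supported_pent; first by exists (6 * k + 1)%N; apply: pent_square.
by exists (6 * k + 5)%N; have := pent_square k; lia.
Qed.

Lemma supported_euler : supported gen_pent (P X).
Proof.
apply: supported_sum (pentagonal int) => k.
by rewrite /pent_term -mulrA; apply: supported_sign; exact: supported_gen_pent.
Qed.

Lemma supported_oddpent_sum : supported gen_pent oddpent_sum.
Proof.
apply: supported_sum oddpent_sumP => k; rewrite -mulrA.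
case: (odd k); first by rewrite mul1r; apply: supported_gen_pent.
by move=> m; rewrite mul0r fcoef0 eqxx.
Qed.

(** A triangular n is itself of this kind, with x = y; otherwise only the term
    4 (-X)^2 R of [S1_theta] contributes, and its parity is that of the
    coefficient of (X)^2 R. *)
Lemma s1_mod8_form n : (s1 n != 0 %[mod 8])%Z ->
  exists x y, (24 * n + 3 = x ^ 2 + 2 * y ^ 2)%N.
Proof.
pose T m := exists k, m = tri k.
have : (exists theta : fps int, has_sum (fun k => (-1) ^+ k * X ^+ tri k) theta).
  eexists; apply: series_has_sum => k; exact/vanishMl/vanishXn/leq_tri.
case=> theta thetaP.
have T1 : supported T theta.
  by apply: supported_sum thetaP => k; apply: supported_sign; apply: supported_Xn; exists k.
have T2 : supported T (tail_series 1 (-1) 0).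
  by apply: supported_sum (tail_series1N int) => k; apply: supported_Xn; exists k.
have [Tn|nT] := boolp.EM (T n).
  case: Tn => k -> _; exists (2 * k + 1)%N, (2 * k + 1)%N.
  by have := tri_square k; lia.
have z f : supported T f -> fcoef f n = 0.
  by move=> h; apply/eqP/negP => /negP /h.
rewrite /s1 (S1_theta thetaP) 2!fcoefD fcoefN (z _ T1) fcoefD (z _ T2) subr0 !add0r.
rewrite eqz_mod_dvd subr0.
set g := _ * oddpent_sum => n8.
have {n8} : ~~ (2 %| fcoef g n)%Z.
  apply: contra n8 => /dvdzP[k gk]; apply/dvdzP; exists k.
  have -> : 4%:R * g = g + g + (g + g) by ring.
  by rewrite !fcoefD gk; ring.
have -> : g = (P (- X) - P X) * ((P (- X) + P X) * oddpent_sum)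
    + P X ^+ 2 * oddpent_sum by rewrite /g; ring.
rewrite fcoefD GRing.rpredDl; last exact/even_coefsMr/even_coefs_qpoch_infB.
rewrite fcoefM => h.
have /existsP[i /andP[hi hj]] : [exists i : 'I_n.+1,
   ~~ (2 %| fcoef (P X ^+ 2) i)%Z && (fcoef oddpent_sum (n - i) != 0)].
  apply: contraR h; rewrite negb_exists => /forallP z'.
  apply: rpred_sum => i _; have := z' i; rewrite negb_and negbK.
  by case/orP => [|/negPn/eqP->]; [exact: dvdz_mulr | rewrite mulr0 dvdz0].
have [a ia /supported_euler[x ex]] := fcoef_sqr_parity hi.
have [y ey] := supported_oddpent_sum hj.
exists y, x; have := ltn_ord i; lia.
Qed.

End Parity.

(** * Primes dividing values of x^2 + 2 y^2 *)

Section Density.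
Local Open Scope nat_scope.

(** The odd primes that remain prime in the ring of the x + y sqrt(-2). *)
Definition inert p := prime p && ((p %% 8 == 5) || (p %% 8 == 7)).

(** Descent: for n > 1, one may take t odd and less than n, so that t^2 + 2 is 3 mod 8 and
    equals m n with m < n odd.  As m again divides t^2 + 2, it is 1 or 3 mod 8,
    and hence so is n. *)
Lemma sqrD2_mod8 n t : odd n -> n %| t ^ 2 + 2 -> (n %% 8 == 1) || (n %% 8 == 3).
Proof.
have [k] := ubnP n; elim: k n t => // k IH n t ltk on dv.
have [->//|n1] := eqVneq n 1.
have n3 : 2 < n by case: n on n1 {ltk dv} => [|[|[|]]].
have [t' [ot tn dt]] : exists t', [/\ odd t', t' <= n & n %| t' ^ 2 + 2].
  have dr : n %| (t %% n) ^ 2 + 2.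
    by rewrite /dvdn -modnDml modnXm modnDml -/(dvdn _ _).
  have ltr : t %% n < n by rewrite ltn_mod; lia.
  have [odd_r|even_r] := boolP (odd (t %% n)).
    by exists (t %% n); split=> //; apply: ltnW.
  (* Since n is odd, t and n - t have opposite parities. *)
  exists (n - t %% n); split; [lia | lia |].
  rewrite -(dvdn_addr _ (dvdn_mulr (2 * (t %% n)) (dvdnn n))).
  set r := t %% n in ltr dr *.
  have -> : n * (2 * r) + ((n - r) ^ 2 + 2) = n * n + (r ^ 2 + 2).
    have [d ->] : exists d, n = d + r by exists (n - r); lia.
    by rewrite addnK; ring.
  by rewrite dvdn_addr // dvdn_mulr.
have tn' : t' <> n.
  move=> e; move: dt; rewrite e dvdn_addr ?dvdn_exp // => /(dvdn_leq (isT : 0 < 2)); lia.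
have [m em] := dvdnP dt.
have t8 : (t' ^ 2 + 2) %% 8 = 3.
  have -> : t' = (t'./2).*2.+1 by lia.
  set h := t'./2.
  have : 2 %| h * h.+1 by rewrite dvdn2 oddM /= andbN.
  move=> /dvdnP[z ez]; have -> : h.*2.+1 ^ 2 + 2 = z * 8 + 3.
    have -> : h.*2.+1 ^ 2 + 2 = 4 * (h * h.+1) + 3 by rewrite -addn1 -muln2; ring.
    by rewrite ez; ring.
  by rewrite modnMDl.
have ltm : m < n.
  have n0 : 0 < n by lia.
  rewrite -(ltn_pmul2r n0) -em -[n * n]/(n ^ 2).
  have le2 : (t' + 2) ^ 2 <= n ^ 2 by rewrite leq_sqr; lia.
  by apply: leq_trans le2; rewrite sqrnD; lia.
have om : odd m.
  have : odd (m * n) by rewrite -em; lia.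
  by rewrite oddM => /andP[].
have dm : m %| t' ^ 2 + 2 by rewrite em dvdn_mulr.
have := IH m t' (leq_trans ltm _) om dm; rewrite -ltnS => /(_ ltk).
move: t8; rewrite em -modnMm.
have : n %% 8 < 8 by rewrite ltn_mod.
have : odd (n %% 8) by lia.
case: (n %% 8) => [|[|[|[|[|[|[|[|]]]]]]]] // _ _ /[swap] /orP[] /eqP -> //.
Qed.

(** If p did not divide y, then x / y would be a square root of -2 modulo p,
    against [sqrD2_mod8].  So p divides both x and y. *)
Lemma inert_dvd_form p x y : inert p -> p %| x ^ 2 + 2 * y ^ 2 -> p ^ 2 %| x ^ 2 + 2 * y ^ 2.
Proof.
move=> /andP[pp p8] dv.
have op : odd p by lia.
have py : p %| y.
  apply: contraT => npy.
  have y0 : 0 < y by rewrite lt0n; apply: contraNneq npy => ->.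
  case: (egcdnP p y0) => u k e _.
  have g1 : gcdn y p = 1 by apply/eqP; rewrite -/(coprime y p) coprime_sym prime_coprime.
  rewrite g1 in e.
  have : p %| (x * u) ^ 2 + 2.
    have : p %| u ^ 2 * (x ^ 2 + 2 * y ^ 2) by apply: dvdn_mull.
    have -> : u ^ 2 * (x ^ 2 + 2 * y ^ 2)
      = p * (2 * k ^ 2 * p + 4 * k) + ((x * u) ^ 2 + 2).
      have -> : u ^ 2 * (x ^ 2 + 2 * y ^ 2) = (x * u) ^ 2 + 2 * (u * y) ^ 2 by ring.
      by rewrite e; ring.
    by rewrite dvdn_addr // dvdn_mulr.
  by move=> /(sqrD2_mod8 op); lia.
have px : p %| x.
  move: dv; rewrite dvdn_addl ?Euclid_dvdX ?andbT //.
  by rewrite dvdn_mull // Euclid_dvdX // py.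
by apply: dvdn_add; [|apply: dvdn_mull]; rewrite dvdn_exp2r.
Qed.

(** The classes 1 and 3 are closed under multiplication modulo 8. *)
Lemma inert_divisor n : n %% 8 = 5 -> exists2 p, inert p & p %| n.
Proof.
move=> n5; apply: contrapT => H.
have {H} H p : prime p -> p %| n -> ~~ inert p.
  by move=> pp pn; apply/negP => ip; apply: H; exists p.
suff : (n %% 8 == 1) || (n %% 8 == 3) by rewrite n5.
have : odd n by lia.
elim/ltn_ind: n {n5} H => n IH H on.
have [->//|n1] := eqVneq n 1.
have n2 : 1 < n by case: n n1 on {IH H} => [|[|]].
have pp := pdiv_prime n2; have pn := pdiv_dvd n.
have [m em] := dvdnP pn.
have : odd m && odd (pdiv n) by rewrite -oddM -em.
case/andP => om op.
have m8 : (m %% 8 == 1) || (m %% 8 == 3).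
  apply: IH => // [|p p' pm]; first by have := prime_gt1 pp; nia.
  by apply: H => //; rewrite em dvdn_mulr.
have := H _ pp pn; rewrite /inert pp /= => p8.
rewrite em -modnMm.
have : pdiv n %% 8 < 8 by rewrite ltn_mod.
have : odd (pdiv n %% 8) by lia.
move: p8; case: (pdiv n %% 8) => [|[|[|[|[|[|[|[|]]]]]]]] // _ _ _;
by case/orP: m8 => /eqP ->.
Qed.

(** * Counting in periodic sets *)

Definition cnt (S : pred nat) n := \sum_(0 <= i < n) S i.
Definition periodic a (S : pred nat) := forall n, S (n + a) = S n.

Lemma leq_cnt (S T : pred nat) n :
  (forall i, S i -> T i) -> cnt S n <= cnt T n.
Proof.
by move=> h; apply: leq_sum => i _; case Si : (S i) => //; rewrite h.
Qed.

Lemma leq_cntr S m n : m <= n -> cnt S m <= cnt S n.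
Proof. by move=> le; rewrite /cnt (big_cat_nat (leq0n m) le) /= leq_addr. Qed.

Lemma cnt_compl S n : cnt S n + cnt (predC S) n = n.
Proof.
rewrite /cnt -big_split /= (eq_bigr (fun=> 1)); last by move=> i _; case: (S i).
by rewrite sum_nat_const_nat subn0 muln1.
Qed.

Lemma periodicM a S k n : periodic a S -> S (n + k * a) = S n.
Proof. by move=> h; elim: k => [|k IH]; rewrite ?addn0 // mulSnr addnA h. Qed.

Lemma periodicW a b S : a %| b -> periodic a S -> periodic b S.
Proof. by move=> /dvdnP[k ->] h n; apply: periodicM. Qed.

Lemma periodic_mod a S n : periodic a S -> S (n %% a) = S n.
Proof. by move=> h; rewrite [in RHS](divn_eq n a) addnC periodicM. Qed.

Lemma cnt_periodM a S L : periodic a S -> cnt S (L * a) = L * cnt S a.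
Proof.
move=> h; elim: L => [|L IH]; first by rewrite mul0n /cnt big_geq.
rewrite !mulSnr -IH /cnt (big_cat_nat (n := L * a)) ?leq_addr //=.
congr (_ + _); rewrite -{1}[L * a]add0n big_addn addKn.
by apply: eq_bigr => i _; rewrite periodicM.
Qed.

Lemma cnt_period_le a S N : 0 < a -> periodic a S ->
  cnt S N <= (N %/ a).+1 * cnt S a.
Proof.
move=> a0 h; rewrite -cnt_periodM //; apply: leq_cntr.
by rewrite ltnW // ltn_ceil.
Qed.

(** Chinese remaindering is a bijection from pairs of residues to residues
    modulo the product. *)
Lemma cnt_crt a b S T : coprime a b -> 0 < a -> 0 < b ->
  periodic a S -> periodic b T ->
  cnt (fun n => S n && T n) (a * b) = cnt S a * cnt T b.
Proof.
move=> co a0 b0 pS pT; rewrite /cnt !big_mkord.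
have ab0 : 0 < a * b by rewrite muln_gt0 a0.
pose h (p : 'I_a * 'I_b) : 'I_(a * b) :=
  Ordinal (ltn_pmod (chinese a b p.1 p.2) ab0).
have h1 p : h p %% a = p.1.
  by rewrite /= modn_dvdm ?dvdn_mulr // chinese_modl // modn_small.
have h2 p : h p %% b = p.2.
  by rewrite /= modn_dvdm ?dvdn_mull // chinese_modr // modn_small.
have hbij : bijective h.
  apply: inj_card_bij; last by rewrite card_prod !card_ord.
  move=> [x y] [x' y'] e; congr (_, _); apply: val_inj.
    by rewrite -[LHS](h1 (x, y)) e h1.
  by rewrite -[LHS](h2 (x, y)) e h2.
(* Periodicity only sees the two residues that define h. *)
rewrite (reindex h) /=; last exact: onW_bij.
rewrite big_distrlr pair_bigA /=; apply: eq_bigr => p _.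
by rewrite -(periodic_mod (h p) pS) -(periodic_mod (h p) pT) h1 h2 mulnb.
Qed.

Lemma sum_multiples p (g : nat -> nat) K : 0 < p ->
  \sum_(0 <= n < K * p) (p %| n) * g n = \sum_(0 <= m < K) g (m * p).
Proof.
move=> p0; elim: K => [|K IH]; first by rewrite mul0n !big_geq.
rewrite big_nat_recr //= -IH mulSnr (big_cat_nat (n := K * p)) ?leq_addr //=.
congr (_ + _); rewrite big_ltn; last by lia.
rewrite dvdn_mull // mul1n big_nat big1 ?addn0 // => i /andP[lo hi].
have -> : i = K * p + (i - K * p) by lia.
rewrite dvdn_addr ?dvdn_mull // gtnNdvd //; lia.
Qed.

(** * The reciprocals of the primes that are 5 or 7 modulo 8 *)

Definition inert_weight p : rat := if inert p then (p%:R^-1)%R else 0%R.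

Definition inert_sum m n : rat := (\sum_(m <= p < n) inert_weight p)%R.

Lemma inert_gt1 p : inert p -> 1 < p.
Proof. by case/andP => /prime_gt1. Qed.

Lemma inert_weight_ge0 p : (0 <= inert_weight p)%R.
Proof. by rewrite /inert_weight; case: ifP => // _; rewrite invr_ge0 ler0n. Qed.

Lemma inert_sum_ge0 m n : (0 <= inert_sum m n)%R.
Proof. by apply: sumr_ge0 => p _; apply: inert_weight_ge0. Qed.

Lemma inert_sum_cat m n p : m <= n -> n <= p ->
  inert_sum m p = (inert_sum m n + inert_sum n p)%R.
Proof. exact: big_cat_nat. Qed.

(** A bounded increasing sequence is Cauchy: otherwise infinitely many
    increments exceed [e]. *)
Lemma inert_tail (K e : rat) : (0 < e)%R -> (forall Z, inert_sum 0 Z <= K)%R ->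
  exists Y, forall Y' Z, Y <= Y' -> (inert_sum Y' Z <= e)%R.
Proof.
move=> e0 bd; apply: contrapT => H.
have step Y : exists Z, (inert_sum 0 Y + e <= inert_sum 0 Z)%R.
  apply: contrapT => nZ; apply: H; exists Y => Y' Z le.
  rewrite leNgt; apply/negP => lt; apply: nZ; exists Z.
  have [le'|lt'] := leqP Z Y'.
    by move: lt; rewrite /inert_sum big_geq // => /(lt_trans e0); rewrite ltxx.
  rewrite (inert_sum_cat (leq0n Y') (ltnW lt')) (inert_sum_cat (leq0n Y) le).
  rewrite -addrA lerD2l; apply: ler_wpDl (ltW lt); exact: inert_sum_ge0.
have many k : exists Z, (k%:R * e <= inert_sum 0 Z)%R.
  elim: k => [|k [Z hZ]]; first by exists 0; rewrite mul0r inert_sum_ge0.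
  have [Z' hZ'] := step Z; exists Z'; apply: le_trans hZ'.
  by rewrite -addn1 natrD mulrDl mul1r lerD2r.
have [k hk] : exists k : nat, (K < k%:R * e)%R.
  exists (Num.Def.archi_bound `|K / e|%R); rewrite -ltr_pdivrMr //.
  apply: le_lt_trans (ler_norm _) _; by apply: archi_boundP; rewrite normr_ge0.
have [Z hZ] := many k.
by have := lt_le_trans hk (le_trans hZ (bd Z)); rewrite ltxx.
Qed.

Definition inert_primorial Y := \prod_(0 <= p < Y | inert p) p.

Lemma inert_primorial_gt0 Y : 0 < inert_primorial Y.
Proof. by apply: prodn_cond_gt0 => p /inert_gt1/ltnW. Qed.

Lemma inert_primorial_dvd Y p : inert p -> p < Y -> p %| inert_primorial Y.
Proof.
move=> ip lt; rewrite /inert_primorial.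
rewrite big_mkcond (bigD1_seq p) ?mem_index_iota ?iota_uniq //= ip.
exact: dvdn_mulr.
Qed.

Lemma inert_primorial_odd Y : odd (inert_primorial Y).
Proof.
elim: Y => [|Y IH]; first by rewrite /inert_primorial big_geq.
rewrite /inert_primorial big_mkcond big_nat_recr //= -big_mkcond oddM IH /=.
by case: ifP => // /andP[_]; lia.
Qed.

Lemma coprime_periodic M : periodic M (coprime M).
Proof. by move=> n; rewrite -coprime_modr modnDr coprime_modr. Qed.

Lemma mod8_periodic : periodic 8 (fun n => n %% 8 == 5).
Proof. by move=> n; rewrite modnDr. Qed.

Lemma cnt_mul_le p M (G : pred nat) X : 0 < p ->
  (forall m, G (m * p) -> (0 < m) && coprime M m) ->
  \sum_(0 <= n < X) (p %| n) * G n
    <= cnt (fun m => (0 < m) && coprime M m) (X %/ p).+1.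
Proof.
move=> p0 h; apply: (@leq_trans (\sum_(0 <= n < (X %/ p).+1 * p) (p %| n) * G n)).
  have le : X <= (X %/ p).+1 * p by rewrite ltnW // ltn_ceil.
  by rewrite (big_cat_nat (leq0n X) le) /= leq_addr.
rewrite sum_multiples //; apply: leq_sum => m _.
by case Gm : (G _) => //; rewrite (h m Gm).
Qed.

(** Suppose the sum converges.  Let M be the product of the inert primes below
    Y, and c the number of residues coprime to M.  Below X = 8 M L there are
    c L integers that are 5 mod 8 and coprime to M.  Each is p m with p >= Y
    inert and m coprime to M.  For p <= L there are at most 16 c L / p such m,
    and for larger p at most X / p.  If the tails of the sum are below 1/64
    from Y on, and below c / (32 M) from L on, this accounts for at most
    c L / 2 integers. *)
Lemma inert_sum_unbounded (K : rat) : exists Z, (K <= inert_sum 0 Z)%R.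
Proof.
apply: contrapT => nK.
have bd Z : (inert_sum 0 Z <= K)%R.
  by rewrite leNgt; apply/negP => /ltW h; apply: nK; exists Z.
have [Y hY] := inert_tail (isT : 0 < 64%:R^-1 :> rat)%R bd.
set M := inert_primorial Y.
have M0 : 0 < M := inert_primorial_gt0 Y.
pose c := cnt (coprime M) M.
have c0 : 0 < c.
  rewrite /c /cnt (bigD1_seq (1 %% M)) ?mem_index_iota ?iota_uniq ?ltn_mod //=.
  by rewrite coprime_modr coprimen1.
have e0 : (0 < c%:R / (32 * M)%:R :> rat)%R.
  by rewrite divr_gt0 // ltr0n // muln_gt0.
have [Y2 hY2] := inert_tail e0 bd.
(* Below X there are L full periods of the class 5 mod 8 coprime to M. *)
pose L := (Y + Y2).+1; pose X := L * (8 * M).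
have L0 : 0 < L by [].
pose G n := (n %% 8 == 5) && coprime M n.
have co8 : coprime 8 M.
  by rewrite (@coprimeXl 3 2) // coprime2n inert_primorial_odd.
have cntG : cnt G X = L * c.
  rewrite cnt_periodM.
    rewrite (cnt_crt co8 _ _ mod8_periodic (@coprime_periodic M)) //.
    by rewrite (_ : cnt _ 8 = 1) ?mul1n // /cnt unlock.
  move=> n; rewrite /G (periodicW (dvdn_mulr M (dvdnn 8)) mod8_periodic).
  by rewrite (periodicW (dvdn_mull 8 (dvdnn M)) (@coprime_periodic M)).
pose B p := cnt (fun m => (0 < m) && coprime M m) (X %/ p).+1.
have cover : cnt G X <= \sum_(Y <= p < X | inert p) B p.
  apply: (@leq_trans (\sum_(0 <= n < X) \sum_(Y <= p < X | inert p) (p %| n) * G n)).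
    rewrite /cnt big_nat [X in _ <= X]big_nat; apply: leq_sum => n /andP[_ ltn].
    case Gn : (G n) => //; case/andP: Gn => /eqP n5 con.
    have [p ip pn] := inert_divisor n5.
    have Yp : Y <= p.
      rewrite leqNgt; apply/negP => lt.
      have : p %| gcdn M n by rewrite dvdn_gcd inert_primorial_dvd.
      by rewrite (eqP con) dvdn1 => /eqP p1; have := inert_gt1 ip; rewrite p1.
    have n0 : 0 < n by case: n n5 {ltn con pn}.
    have pX : p < X by apply: leq_ltn_trans ltn; apply: dvdn_leq.
    rewrite big_mkcond (bigD1_seq p) ?mem_index_iota ?iota_uniq ?Yp //=.
    by rewrite ip pn.
  rewrite exchange_big /=; apply: leq_sum => p ip; apply: cnt_mul_le.
    exact: ltnW (inert_gt1 ip).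
  move=> m /andP[m5]; rewrite coprimeMr => /andP[-> _]; rewrite andbT.
  by case: m m5.
have Bfar p : inert p -> ((B p)%:R <= X%:R * inert_weight p :> rat)%R.
  move=> ip; rewrite /inert_weight ip ler_pdivlMr; last by rewrite ltr0n ltnW ?inert_gt1.
  rewrite -natrM ler_nat; apply: leq_trans (leq_trunc_div X p).
  rewrite leq_mul2r; apply/orP; right.
  rewrite /B /cnt big_nat_recl //= add0n.
  apply: (@leq_trans (\sum_(0 <= i < X %/ p) 1)); last first.
    by rewrite sum_nat_const_nat subn0 muln1.
  by apply: leq_sum => i _; case: (coprime _ _).
have Bnear p : inert p -> p <= L -> ((B p)%:R <= 16%:R * c%:R * L%:R * inert_weight p :> rat)%R.
  move=> ip pL; rewrite /inert_weight ip ler_pdivlMr; last by rewrite ltr0n ltnW ?inert_gt1.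
  rewrite -!natrM ler_nat.
  have p0 := ltnW (inert_gt1 ip).
  have B1 : B p <= ((X %/ p).+1 %/ M).+1 * c.
    apply: leq_trans (cnt_period_le _ M0 (@coprime_periodic M)).
    by apply: leq_cnt => m /andP[].
  apply: leq_trans (leq_mul B1 (leqnn p)) _.
  rewrite (mulnAC _ c p) (mulnAC 16 c L) leq_mul2r; apply/orP; right.
  have h1 : X %/ p * p <= X := leq_trunc_div X p.
  have h2 : (X %/ p).+1 %/ M * M <= (X %/ p).+1 := leq_trunc_div _ M.
  set w := (X %/ p).+1 %/ M in h2 *; set v := X %/ p in h1 h2.
  (* Here p <= L absorbs the two roundings of X / p and of its quotient by M. *)
  have h3 : w * p * M <= 8 * L * M + p by rewrite /X in h1; nia.
  have h4 : w * p <= 9 * L by rewrite -(leq_pmul2r M0); nia.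
  by rewrite mulSn; lia.
have LX : L.+1 <= X by rewrite /X; nia.
have YL : Y <= L.+1 by rewrite /L; lia.
have : ((L * c)%:R <= \sum_(Y <= p < X | inert p) (B p)%:R :> rat)%R.
  by rewrite -natr_sum ler_nat -cntG.
rewrite (big_cat_nat YL LX) /=.
have near_le : (\sum_(Y <= p < L.+1 | inert p) (B p)%:R
            <= 16%:R * c%:R * L%:R * inert_sum Y L.+1 :> rat)%R.
  rewrite /inert_sum mulr_sumr big_mkcond big_nat [X in (_ <= X)%R]big_nat.
  apply: ler_sum => p /andP[_ lt]; case: ifP => ip; first exact: Bnear.
  by rewrite /inert_weight ip mulr0.
have far_le : (\sum_(L.+1 <= p < X | inert p) (B p)%:R
            <= X%:R * inert_sum L.+1 X :> rat)%R.
  rewrite /inert_sum mulr_sumr big_mkcond; apply: ler_sum => p _.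
  by case: ifP => ip; [exact: Bfar | rewrite /inert_weight ip mulr0].
have T1 := hY Y L.+1 (leqnn Y).
have LY2 : Y2 <= L.+1 by rewrite /L; lia.
have T2 := hY2 L.+1 X LY2.
move=> H; have := le_trans H (lerD near_le far_le).
have U1 : (16%:R * c%:R * L%:R * inert_sum Y L.+1 <= (L * c)%:R / 4%:R :> rat)%R.
  apply: le_trans (ler_wpM2l _ T1) _; first by rewrite -!natrM ler0n.
  by rewrite natrM; lra.
have U2 : (X%:R * inert_sum L.+1 X <= (L * c)%:R / 4%:R :> rat)%R.
  apply: le_trans (ler_wpM2l _ T2) _; first by rewrite ler0n.
  rewrite /X !natrM le_eqVlt; apply/orP; left; apply/eqP; field.
  by rewrite pnatr_eq0 -lt0n.
have Lc : (0 < (L * c)%:R :> rat)%R by rewrite ltr0n muln_gt0 c0.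
lra.
Qed.

(** * The values of x^2 + 2 y^2 have density zero *)

Definition exact_dvd p n := (p %| n) && ~~ (p ^ 2 %| n).

Fixpoint sieve Z n :=
  if Z is p.+1 then sieve p n && (inert p ==> ~~ exact_dvd p n) else true.

Definition sieve_mod Z := \prod_(0 <= p < Z | inert p) p ^ 2.

Lemma sieve_modS Z :
  sieve_mod Z.+1 = sieve_mod Z * (if inert Z then Z ^ 2 else 1).
Proof. by rewrite /sieve_mod big_mkcond big_nat_recr //= -big_mkcond. Qed.

Lemma sieve_mod_gt0 Z : 0 < sieve_mod Z.
Proof. by apply: prodn_cond_gt0 => p /inert_gt1/ltnW; rewrite expn_gt0 => ->. Qed.

Lemma exact_dvd_periodic p : periodic (p ^ 2) (predC (exact_dvd p)).
Proof. by move=> n; rewrite /= /exact_dvd !dvdn_addl // dvdn_exp. Qed.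

Lemma sieve_periodic Z : periodic (sieve_mod Z) (sieve Z).
Proof.
elim: Z => [|Z IH] n //=; rewrite sieve_modS.
rewrite (periodicW (dvdn_mulr _ (dvdnn _)) IH); congr (_ && _).
case: (inert Z) => //=.
exact: (periodicW (dvdn_mull _ (dvdnn _)) (@exact_dvd_periodic Z)).
Qed.

Lemma cnt_exact_dvd p : 0 < p -> cnt (predC (exact_dvd p)) (p ^ 2) = p ^ 2 - p + 1.
Proof.
move=> p0; have := cnt_compl (exact_dvd p) (p ^ 2).
suff -> : cnt (exact_dvd p) (p ^ 2) = p.-1 by nia.
have -> : cnt (exact_dvd p) (p ^ 2) = \sum_(0 <= n < p * p) (p %| n) * ~~ (p ^ 2 %| n).
  by apply: eq_bigr => n _; rewrite mulnb.
rewrite sum_multiples // (eq_big_nat _ _ (F2 := fun m => (m != 0) : nat)).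
  case: p p0 => // p _; rewrite big_nat_recl //= add0n.
  by rewrite sum_nat_const_nat subn0 muln1.
move=> m /andP[_ lt]; rewrite expnS expn1 dvdn_pmul2r //.
by case: m lt => [|m] lt; rewrite ?dvdn0 // gtnNdvd.
Qed.

Lemma sieve_mod_coprime Z p : inert p -> Z <= p -> coprime (sieve_mod Z) (p ^ 2).
Proof.
move=> ip; have [pp _] := andP ip; elim: Z => [|Z IH] le.
  by rewrite /sieve_mod big_geq // coprime1n.
rewrite sieve_modS coprimeMl IH ?(ltnW le) //=; case: ifP => [iZ|_]; last exact: coprime1n.
have [pZ _] := andP iZ; rewrite coprimeXl // coprimeXr //.
by rewrite prime_coprime // dvdn_prime2 // ltn_eqF.
Qed.

(** Each inert p contributes the factor 1 - 1/p + 1/p^2, at most 1 - 1/(2p), and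
    the product of the 1 - u_p is at most the inverse of 1 + sum u_p. *)
Lemma cnt_sieve Z :
  ((cnt (sieve Z) (sieve_mod Z))%:R * (1 + inert_sum 0 Z / 2%:R)
    <= (sieve_mod Z)%:R :> rat)%R.
Proof.
elim: Z => [|Z IH].
  have t0 : inert_sum 0 0 = 0%R by rewrite /inert_sum big_geq.
  have m0 : sieve_mod 0 = 1 by rewrite /sieve_mod big_geq.
  by rewrite t0 m0 /cnt big_nat1 mul0r addr0 mulr1.
have tS : inert_sum 0 Z.+1 = (inert_sum 0 Z + inert_weight Z)%R.
  by rewrite /inert_sum big_nat_recr.
rewrite sieve_modS tS /inert_weight; case iZ : (inert Z); last first.
  rewrite muln1 addr0 (_ : cnt _ _ = cnt (sieve Z) (sieve_mod Z)) //.
  by apply: eq_bigr => n _; rewrite /= iZ andbT.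
have -> : cnt (sieve Z.+1) (sieve_mod Z * Z ^ 2)
    = cnt (sieve Z) (sieve_mod Z) * (Z ^ 2 - Z + 1).
  rewrite -cnt_exact_dvd ?(ltnW (inert_gt1 iZ)) // -cnt_crt //.
  - by apply: eq_bigr => n _; rewrite /= iZ.
  - exact: sieve_mod_coprime.
  - exact: sieve_mod_gt0.
  - by rewrite expn_gt0 ltnW // inert_gt1.
  - exact: sieve_periodic.
  - exact: exact_dvd_periodic.
have Z2 : (2%:R <= Z%:R :> rat)%R by rewrite ler_nat inert_gt1.
have -> : (((cnt (sieve Z) (sieve_mod Z)) * (Z ^ 2 - Z + 1))%:R
   = (cnt (sieve Z) (sieve_mod Z))%:R * (Z%:R ^+ 2 - Z%:R + 1) :> rat)%R.
  rewrite natrM natrD natrB ?natrX //.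
  by have := inert_gt1 iZ; nia.
rewrite natrM natrX.
have t0 := inert_sum_ge0 0 Z.
move: IH t0 Z2; move: (inert_sum 0 Z) (Z%:R : rat)%R => t z IH t0 Z2.
have a0 : (0 <= (cnt (sieve Z) (sieve_mod Z))%:R :> rat)%R by rewrite ler0n.
move: IH a0; move: (_%:R)%R => a; move: ((sieve_mod Z)%:R)%R => b IH a0.
apply: le_trans (ler_wpM2r (sqr_ge0 z) IH).
rewrite -!mulrA; apply: ler_wpM2l => //.
have zV : (z * z^-1 = 1)%R by rewrite divff //; apply/eqP => z0; lra.
have v0 : (0 <= z^-1)%R by rewrite invr_ge0; lra.
move: (z^-1)%R zV v0 => v zV v0.
have : (0 <= (z * v) * (z - 1) * (1 + t / 2%:R) - (z ^+ 2 - z + 1) * v / 2%:R)%R.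
  have -> : ((z * v) * (z - 1) * (1 + t / 2%:R) - (z ^+ 2 - z + 1) * v / 2%:R
   = v * (z * (z - 1) * (1 + t / 2%:R) - (z ^+ 2 - z + 1) / 2%:R))%R by ring.
  apply: mulr_ge0 => //.
  have s2 : (2%:R <= z * (z - 1))%R by nra.
  have st : (0 <= z * (z - 1) * t)%R by apply: mulr_ge0 => //; lra.
  lra.
rewrite zV mul1r => h; rewrite -subr_ge0; move: h.
by congr (0 <= _)%R; field.
Qed.

Lemma sieve_form Z x y : sieve Z (x ^ 2 + 2 * y ^ 2).
Proof.
elim: Z => //= Z ->; apply/implyP => iZ; apply/negP => /andP[d /negP[]].
exact: inert_dvd_form.
Qed.

(** A period of the sieve up to Z contains a proportion of at most 1 / (1 + 2 k)
    once the sum of the 1/p reaches 4 k. *)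
Lemma form_density0 (S : pred nat) k :
  (forall n, S n -> exists x y, n = x ^ 2 + 2 * y ^ 2) ->
  exists N0, forall N, N0 <= N -> k * cnt S N <= N.
Proof.
move=> hS; have [Z hZ] := inert_sum_unbounded (4 * k)%:R%R.
exists (sieve_mod Z) => N leN; set Q := sieve_mod Z in leN *.
have Q0 : 0 < Q := sieve_mod_gt0 Z.
have c1 : cnt S N <= (N %/ Q).+1 * cnt (sieve Z) Q.
  apply: leq_trans (cnt_period_le _ Q0 (@sieve_periodic Z)).
  by apply: leq_cnt => n /hS[x [y ->]]; apply: sieve_form.
have c2 : cnt (sieve Z) Q * (1 + 2 * k) <= Q.
  rewrite -(ler_nat rat) natrM; apply: le_trans (cnt_sieve Z).
  apply: ler_wpM2l; first by rewrite ler0n.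
  by rewrite natrD natrM lerD2l ler_pdivlMr //; rewrite -!natrM mulnAC in hZ *.
have c3 : (N %/ Q).+1 * Q <= 2 * N.
  have := leq_trunc_div N Q; lia.
have : cnt S N * (1 + 2 * k) <= 2 * N.
  apply: leq_trans (leq_mul c1 (leqnn _)) _.
  by rewrite -mulnA; apply: leq_trans c3; rewrite leq_mul2l c2 orbT.
nia.
Qed.

End Density.

(** * The density statement *)

Definition form_values : pred nat :=
  fun n => `[< exists x y, (n = x ^ 2 + 2 * y ^ 2)%N >].

Lemma card_nonmultiples n :
  (#|[set m : 'I_n.+1 | (s1 m != 0 %[mod 8])%Z]%SET|
    <= cnt form_values (24 * n.+1))%N.
Proof.
rewrite cardsE -sum1_card big_mkcond /=.
rewrite (eq_bigr (fun m : 'I_n.+1 => (s1 m != 0 %[mod 8])%Z : nat)); last first.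
  by move=> m _; rewrite unfold_in; case: ifP.
rewrite -(big_mkord xpredT (fun m => (s1 m != 0 %[mod 8])%Z : nat)).
elim: n.+1 => {n} [|n IH]; first by rewrite big_geq.
rewrite big_nat_recr //= mulnSr.
rewrite /cnt (big_cat_nat (leq0n _) (leq_addr 24 (24 * n))) /=.
apply: leq_add IH _.
case: (boolP (s1 n != 0 %[mod 8])%Z) => [nz|_] //.
rewrite (bigD1_seq (24 * n + 3)%N) ?mem_index_iota ?iota_uniq //=; last by lia.
suff -> : form_values (24 * n + 3) by [].
exact/asboolP/s1_mod8_form.
Qed.

Theorem theorem1p5 (R : realType) :
  (fun n : nat =>
     #|[set m : 'I_n.+1 | (s1 m != 0 %[mod 8])%Z]%SET|%:R / n%:R : R)
    @ \oo --> (0 : R).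
Proof.
apply/cvgr0Pnorm_le => e e0.
(* The counts up to n are at most those of the form up to 24 (n + 1) <= 48 n. *)
pose k := (Num.Def.archi_bound (48%:R / e)).
have ke : 48%:R <= k%:R * e.
  rewrite -ler_pdivrMr // ltW // archi_boundP // divr_ge0 ?ler0n // ltW //.
have [N0 hN] := @form_density0 form_values k (fun n => @asboolW _).
near=> n.
have n0 : (0 < n)%N by near: n; exact: nbhs_infty_gt.
have Nn : (N0 <= n)%N by near: n; exact: nbhs_infty_ge.
have kn : (k * #|[set m : 'I_n.+1 | (s1 m != 0 %[mod 8])%Z]%SET| <= 48 * n)%N.
  apply: leq_trans (leq_mul (leqnn k) (card_nonmultiples n)) _.
  by apply: leq_trans (hN _ _) _; lia.
have k0 : 0 < k%:R :> R.
  by rewrite -(pmulr_lgt0 _ e0); apply: lt_le_trans ke; rewrite ltr0n.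
rewrite ger0_norm ?divr_ge0 ?ler0n // ler_pdivrMr ?ltr0n //.
rewrite -(ler_pM2l k0) -natrM; apply: (@le_trans _ _ (48 * n)%:R).
  by rewrite ler_nat.
by rewrite natrM mulrA ler_wpM2r ?ler0n.
Unshelve. all: by end_near.
Qed.
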